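(* Let $n\in\mathbb N_0$ and let $K$ be a non-empty collection of subsets of $\{1,\dots,n\}$ which is downwards-closed, i.e., if $A\in K$ and $B\subseteq A$ then $B\in K$. Then the inclusion $$\bigcup_{A\in K}\Box^{|A|}\to\Box^n$$ is a trivial cofibration.
   Context: The cube category $\Box$ has objects $\{0,1\}^n$ ($n\in\mathbb N_0$) and morphisms the maps $\{0,1\}^n\to\{0,1\}^m$ that are restrictions of affine linear maps $\mathbb Z^n\to\mathbb Z^m$. A cubeset is a presheaf of sets on $\Box$; $\Box^n$ denotes the presheaf represented by $\{0,1\}^n$. For $1\le i\le n$, $\varepsilon_i\colon\{0,1\}^{n-1}\to\{0,1\}^n$ inserts a $0$ at coordinate $i$; for $n\ge1$ the corner $\Lambda^n\subseteq\Box^n$ is the union of the images of $\varepsilon_1,\dots,\varepsilon_n\colon\Box^{n-1}\to\Box^n$. A map of cubesets is a fibration if it has the right lifting property against all inclusions $\Lambda^m\to\Box^m$, $m\ge1$. A trivial cofibration is a map of cubesets having the left lifting property against all fibrations. For $A\subseteq\{1,\dots,n\}$ with $k$ elements, $\Box^{|A|}=\Box^k\to\Box^n$ is the subobject given by the (linear, order-preserving on coordinates) inclusion $\{0,1\}^k\to\{0,1\}^n$ whose image is $\{x\in\{0,1\}^n: x_i=0\text{ for all }i\notin A\}$. The union is taken among subobjects of the presheaf $\Box^n$. *)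

(* Defs.v *)
From HB Require Import structures.
From mathcomp Require Import all_boot all_order all_algebra.
From mathcomp Require Import boolp classical_sets.

Set Implicit Arguments.
Unset Strict Implicit.
Unset Printing Implicit Defensive.

Import GRing.Theory.

Local Open Scope classical_set_scope.
Local Open Scope ring_scope.

Definition cube (n : nat) : Type := {ffun 'I_n -> bool}.
HB.instance Definition _ n := Finite.on (cube n).

Definition cube_vec (n : nat) (x : cube n) : 'cV[int]_n := \col_i (x i)%:R.

Definition is_affine (m n : nat) (f : cube m -> cube n) : Prop :=
  exists (M : 'M[int]_(n, m)) (b : 'cV[int]_n),
    forall x, cube_vec (f x) = M *m cube_vec x + b.

(* The affine map is only required to exist: morphisms are maps of cubes.
   [asbool] makes [box m n] a subtype, so morphisms with equal underlying maps
   are equal. *)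
Record box (m n : nat) := Box {
  box_fun :> {ffun cube m -> cube n};
  box_affine : `[< is_affine box_fun >] }.

HB.instance Definition _ m n := [isSub for @box_fun m n].

Lemma box_ext (m n : nat) (f g : box m n) : f =1 g -> f = g.
Proof. by move=> fg; apply/val_inj/ffunP. Qed.

Definition mkbox (m n : nat) (f : cube m -> cube n) (fP : is_affine f) :
  box m n.
Proof.
exists (finfun f); apply/asboolP.
by case: fP => M [b Mb]; exists M, b => x; rewrite ffunE.
Defined.

Lemma mkboxE (m n : nat) (f : cube m -> cube n) (fP : is_affine f) :
  mkbox fP =1 f.
Proof. exact: ffunE. Qed.

Lemma is_affine_id (n : nat) : is_affine (@id (cube n)).
Proof. by exists 1%:M, 0 => x; rewrite mul1mx addr0. Qed.

Lemma is_affine_comp (m n p : nat) (g : box n p) (f : box m n) :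
  is_affine (fun x => g (f x)).
Proof.
have /asboolP[M [b Mb]] := box_affine g.
have /asboolP[N [c Nc]] := box_affine f.
exists (M *m N), (M *m c + b) => x.
by rewrite Mb Nc mulmxDr mulmxA addrA.
Qed.

Definition box_id (n : nat) : box n n := mkbox (@is_affine_id n).

Definition box_comp (m n p : nat) (g : box n p) (f : box m n) : box m p :=
  mkbox (is_affine_comp g f).

Record cubeset := Cubeset {
  cells :> nat -> Type;
  restr : forall m n, box m n -> cells n -> cells m;
  restr_id : forall n (x : cells n), restr (box_id n) x = x;
  restr_comp : forall m n p (g : box n p) (f : box m n) (x : cells p),
    restr (box_comp g f) x = restr f (restr g x) }.

Record cmap (X Y : cubeset) := Cmap {
  cmap_fun :> forall n, X n -> Y n;
  cmap_nat : forall m n (f : box m n) (x : X n),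
    cmap_fun (restr f x) = restr f (cmap_fun x) }.

Definition repr_cube (n : nat) : cubeset.
Proof.
exists (fun m => box m n) (fun l m f g => box_comp g f).
- by move=> m x; apply: box_ext => y; rewrite !mkboxE.
- by move=> l m p g f x; apply: box_ext => y; rewrite !mkboxE.
Defined.

Definition repr_map (m n : nat) (f : box m n) :
  cmap (repr_cube m) (repr_cube n).
Proof.
exists (fun l (g : repr_cube m l) => box_comp f g : repr_cube n l).
by move=> k l h g; apply: box_ext => y; rewrite !mkboxE.
Defined.

Record subcubeset (X : cubeset) := Subcubeset {
  subcells : forall n, set (X n);
  subcells_restr : forall m n (f : box m n) (x : X n),
    subcells x -> subcells (restr f x) }.

Definition sub_cubeset (X : cubeset) (S : subcubeset X) : cubeset.
Proof.
exists (fun n => {x : X n | x \in @subcells X S n})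
  (fun m n f x => exist _ (restr f (sval x))
     (mem_set (subcells_restr f (set_mem (svalP x))))).
- by move=> n x; apply/val_inj/restr_id.
- by move=> m n p g f x; apply/val_inj/restr_comp.
Defined.

Definition sub_incl (X : cubeset) (S : subcubeset X) :
  cmap (sub_cubeset S) X.
Proof. by exists (fun n (x : sub_cubeset S n) => sval x). Defined.

Definition image_sub (X Y : cubeset) (f : cmap X Y) : subcubeset Y.
Proof.
exists (fun n => range (@cmap_fun X Y f n)).
by move=> m n g _ [x _ <-]; exists (restr g x); rewrite ?cmap_nat.
Defined.

Definition bigcup_sub (X : cubeset) (I : Type) (P : set I)
  (S : I -> subcubeset X) : subcubeset X.
Proof.
exists (fun n => \bigcup_(i in P) @subcells X (S i) n).
by move=> m n f x [i Pi Six]; exists i => //; apply: subcells_restr.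
Defined.

Definition insert0 (n : nat) (i : 'I_n.+1) (x : cube n) : cube n.+1 :=
  [ffun j => if unlift i j is Some k then x k else false].

Lemma is_affine_insert0 (n : nat) (i : 'I_n.+1) : is_affine (insert0 i).
Proof.
exists (\matrix_(j, k) (j == lift i k)%:R), 0 => x.
apply/colP => j; rewrite addr0 !mxE ffunE.
case: unliftP => [k|] ->.
  rewrite (bigD1 k) //= !mxE eqxx mul1r big1 ?addr0 // => l lk.
  by rewrite !mxE (inj_eq (@lift_inj _ i)) eq_sym (negPf lk) mul0r.
by rewrite big1 // => k _; rewrite !mxE (negPf (neq_lift _ _)) mul0r.
Qed.

Definition face0 (n : nat) (i : 'I_n.+1) : box n n.+1 :=
  mkbox (is_affine_insert0 i).

(* Corners exist in positive dimension only: [corner n] is the corner of the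
   cube of dimension [n.+1]. *)
Definition corner (n : nat) : subcubeset (repr_cube n.+1) :=
  bigcup_sub setT (fun i : 'I_n.+1 => image_sub (repr_map (face0 i))).

Definition lifts (A B X Y : cubeset) (i : cmap A B) (p : cmap X Y) : Prop :=
  forall (u : cmap A X) (v : cmap B Y),
    (forall n (a : A n), p n (u n a) = v n (i n a)) ->
    exists h : cmap B X,
      (forall n (a : A n), h n (i n a) = u n a) /\
      (forall n (b : B n), p n (h n b) = v n b).

Definition fibration (X Y : cubeset) (p : cmap X Y) : Prop :=
  forall m : nat, lifts (sub_incl (corner m)) p.

Definition trivial_cofibration (A B : cubeset) (i : cmap A B) : Prop :=
  forall (X Y : cubeset) (p : cmap X Y), fibration p -> lifts i p.

(* [enum_val] lists the elements of [A] in increasing order, so coordinate [j]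
   of [x] becomes the coordinate indexed by the [j]-th element of [A]; the
   coordinates outside [A] are 0. *)
Definition extend0 (n : nat) (A : {set 'I_n}) (x : cube #|A|) : cube n :=
  [ffun i => [exists j : 'I_#|A|, (enum_val j == i) && x j]].

Lemma is_affine_extend0 (n : nat) (A : {set 'I_n}) : is_affine (@extend0 n A).
Proof.
exists (\matrix_(i, j) (enum_val j == i)%:R), 0 => x.
apply/colP => i; rewrite addr0 !mxE ffunE.
case: existsP => [[j /andP[/eqP ji xj]]|noj].
  rewrite (bigD1 j) //= !mxE ji eqxx xj mul1r big1 ?addr0 // => k kj.
  by rewrite !mxE -ji (inj_eq enum_val_inj) (negPf kj) mul0r.
rewrite big1 // => j _; rewrite !mxE.
case: eqP => [ji|_]; last by rewrite mul0r.
case xj: (x j); last by rewrite mulr0.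
by case: noj; exists j; rewrite ji eqxx xj.
Qed.

Definition coord_face (n : nat) (A : {set 'I_n}) : box #|A| n :=
  mkbox (@is_affine_extend0 n A).

Definition coord_face_union (n : nat) (K : {set {set 'I_n}}) :
  subcubeset (repr_cube n) :=
  bigcup_sub [set` K]
    (fun A : {set 'I_n} => image_sub (repr_map (coord_face A))).

(* Main.v *)
Require Import Defs.
From mathcomp Require Import all_boot all_order all_algebra.
From mathcomp Require Import boolp classical_sets.

(** A cell of a cube is an affine map into [{0,1}^n]; call support the set of
    coordinates at which it is not constantly 0.  For a downwards-closed [K],
    all subobjects involved are read off the support: the union of the faces
    indexed by [K] consists of the cells whose support belongs to [K]
    ([coord_face_unionE]), and the corner of the cells whose support is not
    everything ([cornerE]).

    If [K] does not contain all subsets, take a subset [B] of least size outside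
    [K].  All its proper subsets lie in [K] and no superset of [B] does, so the
    face of [B] meets the union in exactly the corner of that face
    ([coord_face_meets_in_corner]), and [B] is non-empty since [K] contains the
    empty set.  Hence adding the face of [B] is a pushout of a corner inclusion,
    along which lifts extend ([trivial_cofibration_attach]), and [B |: K] is
    again downwards-closed.  Repeating this exhausts the subsets, and for the
    collection of all subsets the inclusion is an isomorphism. *)

Set Implicit Arguments.
Unset Strict Implicit.
Unset Printing Implicit Defensive.

Import GRing.Theory.

Local Open Scope ring_scope.

(** * Subobjects and attaching cells *)

Lemma subcubeset_ext (X : cubeset) (S T : subcubeset X) :
  (forall n (x : X n), subcells S x <-> subcells T x) -> S = T.
Proof.
case: S T => [S Sr] [T Tr] /= ST.
have E : S = T.
  by apply: functional_extensionality_dep => n; apply/funext => x; apply/propext.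
by rewrite -{}E in Tr *; congr Subcubeset; apply: Prop_irrelevance.
Qed.

Definition subcell (X : cubeset) (S : subcubeset X) n (x : X n)
  (Sx : subcells S x) : sub_cubeset S n := exist _ x (mem_set Sx).

Lemma subcell_val (X : cubeset) (S : subcubeset X) n (a : sub_cubeset S n)
  (Sa : subcells S (sval a)) : subcell Sa = a.
Proof. exact: val_inj. Qed.

Lemma subcellP (X : cubeset) (S : subcubeset X) n (a : sub_cubeset S n) :
  subcells S (sval a).
Proof. exact: set_mem (svalP a). Qed.

(** A map out of a union is prescribed on each piece, hence a priori only as a
    relation; restriction stability and uniqueness of values give naturality. *)
Lemma cmap_of_graph (X Y : cubeset) (R : forall n, X n -> Y n -> Prop) :
  (forall n x, exists y, R n x y) ->
  (forall n x y y', R n x y -> R n x y' -> y = y') ->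
  (forall m n (f : box m n) x y, R n x y -> R m (restr f x) (restr f y)) ->
  exists h : cmap X Y, forall n x, R n x (h n x).
Proof.
move=> Rtot Rfun Rrestr.
pose h n x := sval (cid (Rtot n x)).
have hR n x : R n x (h n x) by rewrite /h; case: cid.
have hnat m n (f : box m n) x : h m (restr f x) = restr f (h n x).
  by apply: Rfun (hR _ _) _; apply: Rrestr.
by exists (Cmap hnat).
Qed.

Definition cmap_comp (X Y Z : cubeset) (g : cmap Y Z) (f : cmap X Y) :
  cmap X Z.
Proof.
by exists (fun n x => g n (f n x)) => m n k x; rewrite !cmap_nat.
Defined.

Definition sub_restrict (W Z : cubeset) (phi : cmap W Z) (T : subcubeset W)
  (S : subcubeset Z)
  (TS : forall n (w : W n), subcells T w -> subcells S (phi n w)) :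
  cmap (sub_cubeset T) (sub_cubeset S).
Proof.
exists (fun n a => subcell (TS n _ (subcellP a))).
by move=> m n f a; apply: val_inj; rewrite /= cmap_nat.
Defined.

Lemma trivial_cofibration_full (Z : cubeset) (S : subcubeset Z) :
  (forall n (z : Z n), subcells S z) -> trivial_cofibration (sub_incl S).
Proof.
move=> Sfull X Y p _ u v uv.
have hnat m n (f : box m n) z :
    u m (subcell (Sfull m (restr f z))) = restr f (u n (subcell (Sfull n z))).
  by rewrite -cmap_nat; congr (u m _); apply: val_inj.
exists (Cmap hnat); split=> n z /=; first by rewrite subcell_val.
by rewrite uv.
Qed.

(** Since [phi] is a monomorphism pulling [S] back to [T], the union [S'] is the
    pushout of [S] and [W] over [T].  A lift on [W] relative to [T] therefore
    glues with the given map on [S]. *)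
Lemma trivial_cofibration_attach (W Z : cubeset) (phi : cmap W Z)
  (T : subcubeset W) (S S' : subcubeset Z) :
  (forall n, injective (phi n)) ->
  (forall n (w : W n), subcells S (phi n w) <-> subcells T w) ->
  (forall n (z : Z n),
     subcells S' z <-> subcells S z \/ exists w, phi n w = z) ->
  trivial_cofibration (sub_incl T) -> trivial_cofibration (sub_incl S') ->
  trivial_cofibration (sub_incl S).
Proof.
move=> phi_inj ST S'E Tcof S'cof X Y p pfib u v uv.
pose j := sub_restrict (fun n w => (ST n w).2).
have [|hT [hTu hTv]] := Tcof X Y p pfib (cmap_comp u j) (cmap_comp v phi).
  by move=> n a; rewrite /= uv.
pose R n (z : sub_cubeset S' n) (x : X n) :=
  (exists2 s : sub_cubeset S n, sval s = sval z & x = u n s) \/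
  (exists2 w : W n, phi n w = sval z & x = hT n w).
have agree n (s : sub_cubeset S n) w : sval s = phi n w -> u n s = hT n w.
  move=> sw; have Tw : subcells T w by apply/ST; rewrite -sw; apply: subcellP.
  rewrite -[w]/(sub_incl T n (subcell Tw)) hTu /=.
  by congr (u n _); apply: val_inj.
have [||| u' Ru'] := @cmap_of_graph (sub_cubeset S') X R.
- move=> n z; have [Sz|[w wz]] := (S'E n _).1 (subcellP z).
    by exists (u n (subcell Sz)); left; exists (subcell Sz).
  by exists (hT n w); right; exists w.
- move=> n z x x' [[s sz ->]|[w wz ->]] [[s' sz' ->]|[w' wz' ->]].
  + by congr (u n _); apply: val_inj; rewrite /= sz.
  + by apply: agree; rewrite wz'.
  + by apply/esym/agree; rewrite wz.
  + by congr (hT n _); apply: phi_inj; rewrite wz.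
- move=> m n f z x [[s sz ->]|[w wz ->]]; rewrite -cmap_nat.
    by left; exists (restr f s) => //=; rewrite sz.
  by right; exists (restr f w) => //=; rewrite cmap_nat wz.
have [|h [hu' hv]] := S'cof X Y p pfib u' v.
  move=> n z; case: (Ru' n z) => -[a az ->] /=; first by rewrite uv /= az.
  by rewrite hTv /= az.
exists h; split=> // n s.
have S's : subcells S' (sval s) by apply/S'E; left; apply: subcellP.
rewrite -[sub_incl S n s]/(sub_incl S' n (subcell S's)) hu'.
case: (Ru' n (subcell S's)) => -[a /= az ->]; last by apply/esym/agree.
by congr (u n _); apply: val_inj.
Qed.

(** * Supports of cells of a cube *)

Definition support (m n : nat) (f : box m n) : {set 'I_n} :=
  [set i | [exists y, f y i]].

Lemma supportP (m n : nat) (f : box m n) i :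
  reflect (exists y, f y i) (i \in support f).
Proof. by rewrite inE; apply: existsP. Qed.

Lemma notin_support (m n : nat) (f : box m n) i y :
  i \notin support f -> f y i = false.
Proof.
by move=> fi; apply: contraNF fi => fyi; apply/supportP; exists y.
Qed.

Lemma is_affine_reindex (m n : nat) (s : 'I_m -> 'I_n) :
  is_affine (fun x : cube n => [ffun j => x (s j)] : cube m).
Proof.
exists (\matrix_(j, i) (s j == i)%:R), 0 => x.
apply/colP => j; rewrite addr0 !mxE ffunE (bigD1 (s j)) //= !mxE eqxx mul1r.
by rewrite big1 ?addr0 // => i ij; rewrite mxE eq_sym (negPf ij) mul0r.
Qed.

Definition reindex_box (m n : nat) (s : 'I_m -> 'I_n) : box n m :=
  mkbox (is_affine_reindex s).

Lemma reindex_boxE (m n : nat) (s : 'I_m -> 'I_n) x j :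
  reindex_box s x j = x (s j).
Proof. by rewrite mkboxE ffunE. Qed.

Lemma repr_mapE (l m n : nat) (f : box m n) (g : box l m) y :
  (repr_map f l g : box l n) y = f (g y).
Proof. exact: mkboxE. Qed.

Lemma face0_in (n : nat) (i : 'I_n.+1) x k : face0 i x (lift i k) = x k.
Proof. by rewrite mkboxE ffunE liftK. Qed.

Lemma face0_out (n : nat) (i : 'I_n.+1) x : face0 i x i = false.
Proof. by rewrite mkboxE ffunE unlift_none. Qed.

Lemma coord_face_in (n : nat) (A : {set 'I_n}) x k :
  coord_face A x (enum_val k) = x k.
Proof.
rewrite mkboxE ffunE; apply/existsP/idP => [[j /andP[/eqP/enum_val_inj ->]]|xk] //.
by exists k; rewrite eqxx.
Qed.

Lemma coord_face_out (n : nat) (A : {set 'I_n}) x i :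
  i \notin A -> coord_face A x i = false.
Proof.
rewrite mkboxE ffunE => iA; apply: contraNF iA => /existsP[j /andP[/eqP <- _]].
exact: enum_valP.
Qed.

(** The preimage of a cell is found by reading off the coordinates in [A]. *)
Lemma coord_face_image (m n : nat) (A : {set 'I_n}) (f : box m n) :
  (exists g, repr_map (coord_face A) m g = f) <-> support f \subset A.
Proof.
split=> [[g <-]|fA].
  apply/fintype.subsetP => i /supportP[y]; rewrite repr_mapE.
  by apply: contraTT => /coord_face_out ->.
exists (box_comp (reindex_box (@enum_val _ (mem A))) f).
apply: box_ext => y; apply/ffunP => i; rewrite repr_mapE.
have [iA|iA] := boolP (i \in A).
  rewrite -(enum_rankK_in iA iA) coord_face_in.
  by rewrite (repr_mapE (reindex_box _)) reindex_boxE.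
rewrite coord_face_out // notin_support //.
by apply: contra iA; apply: (fintype.subsetP fA).
Qed.

Lemma coord_face_inj (n : nat) (A : {set 'I_n}) m :
  injective (repr_map (coord_face A) m).
Proof.
move=> g g' /(congr1 (@box_fun _ _)) /ffunP E.
apply: box_ext => y; apply/ffunP => k.
have /(congr1 (fun c : cube n => c (enum_val k))) := E y.
by rewrite !(repr_mapE (coord_face A)) !coord_face_in.
Qed.

Lemma support_coord_face (m n : nat) (A : {set 'I_n}) (g : box m #|A|) :
  support (repr_map (coord_face A) m g) = [set enum_val k | k in support g].
Proof.
apply/setP => i; apply/supportP/imsetP => [[y]|[k /supportP[y gyk] ->]]; last first.
  by exists y; rewrite repr_mapE coord_face_in.
rewrite repr_mapE => fyi; have iA : i \in A.
  by apply: contraLR fyi => /coord_face_out ->.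
exists (enum_rank_in iA i); last by rewrite enum_rankK_in.
apply/supportP; exists y.
by rewrite -(coord_face_in (A := A)) enum_rankK_in.
Qed.

Lemma coord_face_unionE (m n : nat) (K : {set {set 'I_n}}) (f : box m n) :
  (forall A B : {set 'I_n}, A \in K -> B \subset A -> B \in K) ->
  @subcells _ (coord_face_union K) m f <-> support f \in K.
Proof.
move=> Kdown; split=> [[A AK [g _ gf]]|fK].
  by apply: Kdown AK _; apply/coord_face_image; exists g.
have [g gf] := (coord_face_image (support f) f).2 (fintype.subxx _).
by exists (support f) => //; exists g.
Qed.

Lemma cornerE (m n : nat) (f : box m n.+1) :
  @subcells _ (corner n) m f <-> support f != finset.setT.
Proof.
split=> [[i _ [g _ <-]]|].
  apply/eqP => /setP/(_ i); rewrite finset.in_setT => /supportP[y].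
  by rewrite repr_mapE face0_out.
rewrite -finset.properT => /properP[_ [i _ fi]].
exists i => //; exists (box_comp (reindex_box (lift i)) f) => //.
apply: box_ext => y; apply/ffunP => j; rewrite repr_mapE.
case: (unliftP i j) => [k|] ->.
  by rewrite face0_in (repr_mapE (reindex_box _)) reindex_boxE.
by rewrite face0_out notin_support.
Qed.

(** * Attaching a minimal missing face *)

(** The corner written in terms of supports, so that it makes sense in the
    dimension [#|B|] without exhibiting it as a successor. *)
Definition proper_support (n : nat) : subcubeset (repr_cube n).
Proof.
exists (fun m (f : repr_cube n m) => is_true (support f != finset.setT)).
move=> l m g f; rewrite -!finset.properT; apply: sub_proper_trans.
apply/fintype.subsetP => i /supportP[y]; rewrite mkboxE => fi.
by apply/supportP; exists (g y).
Defined.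

Lemma proper_support_trivial_cofibration (n : nat) :
  (0 < n)%N -> trivial_cofibration (sub_incl (proper_support n)).
Proof.
case: n => // n _; have -> : proper_support n.+1 = corner n.
  by apply: subcubeset_ext => m f; split=> /cornerE.
by move=> X Y p pfib; apply: pfib.
Qed.

Lemma coord_face_meets_in_corner (m n : nat) (K : {set {set 'I_n}})
  (B : {set 'I_n}) (g : box m #|B|) :
  B \notin K -> (forall A : {set 'I_n}, A \proper B -> A \in K) ->
  (support (repr_map (coord_face B) m g) \in K) =
  (support g != finset.setT).
Proof.
move=> BK Bmin; rewrite support_coord_face.
have [->|gT] := eqVneq (support g) finset.setT.
  suff -> : [set enum_val k | k in [set: 'I_#|B|]] = B by apply/negbTE.
  apply/setP => i; apply/imsetP/idP => [[k _ ->]|iB]; first exact: enum_valP.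
  by exists (enum_rank_in iB i); rewrite ?finset.in_setT ?enum_rankK_in.
apply: Bmin; rewrite properEcard card_imset; last exact: enum_val_inj.
rewrite -[X in (_ < X)%N]card_ord -cardsT proper_card ?finset.properT // andbT.
by apply/fintype.subsetP => _ /imsetP[k _ ->]; apply: enum_valP.
Qed.

Theorem mainTheorem6 (n : nat) (K : {set {set 'I_n}})
  (K_neq0 : K != finset.set0)
  (K_down : forall A B : {set 'I_n}, A \in K -> B \subset A -> B \in K) :
  trivial_cofibration (sub_incl (coord_face_union K)).
Proof.
have [c] := ubnP #|~: K|; elim: c => // c IHc in K K_neq0 K_down *.
rewrite ltnS => Kc.
have [TK|TK] := boolP (finset.setT \in K).
  apply: trivial_cofibration_full => m f; apply/coord_face_unionE => //.
  exact: K_down TK (finset.subsetT _).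
case: (@arg_minnP _ _ [pred A | A \notin K] (fun A : {set _} => #|A|) TK) => B /= BK Bleast.
have Bmin (A : {set _}) : A \proper B -> A \in K.
  by move=> /proper_card; apply: contraTT => /Bleast; rewrite -leqNgt.
have B_gt0 : (0 < #|B|)%N.
  rewrite card_gt0; apply: contra BK => /eqP ->.
  by have /set0Pn[A AK] := K_neq0; apply: K_down AK (finset.sub0set _).
have BK_down (A A' : {set _}) : A \in B |: K -> A' \subset A -> A' \in B |: K.
  rewrite !in_setU1 => /orP[/eqP ->|AK A'A]; last by rewrite (K_down A) ?orbT.
  by rewrite subEproper => /orP[->//|/Bmin ->]; rewrite orbT.
apply: (@trivial_cofibration_attach _ _ (repr_map (coord_face B))
  (proper_support #|B|) _ (coord_face_union (B |: K))).
- exact: coord_face_inj.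
- move=> m g /=; rewrite -(coord_face_meets_in_corner g BK Bmin).
  exact: coord_face_unionE.
- move=> m f; rewrite coord_face_image !coord_face_unionE // in_setU1.
  rewrite orbC; split=> [/orP[|/eqP ->]|[->//|]]; [by left|by right|].
  by rewrite subEproper => /orP[->|/Bmin ->//]; rewrite orbT.
- exact: proper_support_trivial_cofibration.
- apply: IHc => //; first by apply/set0Pn; exists B; rewrite setU11.
  apply: leq_trans Kc; apply: proper_card; rewrite finset.properC.
  apply/properP; split; first exact: finset.subsetUr.
  by exists B; rewrite ?setU11.
Qed.
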